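(* Let $G=(V,E)$ be a simple biconnected planar cubic graph with $3n$ edges ($n\ge 2$), embedded in the plane, so that it has $2n$ vertices and $n+2$ faces $F_1,\dots,F_{n+2}$. For $\alpha\in\{-1,1\}^V\subseteq(\mathbb F_3^* )^V$ let $\mathrm{FM}(\alpha)$ be the $(n+2)\times(n+2)$ matrix over $\mathbb F_3$ whose $(i,j)$ entry is $\sum_{v\in F_i\cap F_j}\alpha(v)$. Then $$\chi'_G(3)=3\sum_{\alpha}\Bigl(-\tfrac13\Bigr)^{\operatorname{rank}(\mathrm{FM}(\alpha))/2}\operatorname{sign}(\mathrm{FM}(\alpha)),$$ where the sum runs over all $\alpha\in\{-1,1\}^V$ for which $\operatorname{rank}(\mathrm{FM}(\alpha))$ is even.
   Context: A vertex $v$ belongs to a face $F$ if it lies on the boundary of $F$. A Tait coloring of $G$ is a coloring of the edges with 3 colors such that edges sharing a vertex receive different colors; $\chi'_G(3)$ is the number of Tait colorings. For a symmetric matrix $C$ over $\mathbb F_3$ of rank $\rho\ge1$, $\operatorname{sign}(C)=\left(\frac{\det C'}{3}\right)$ (Legendre symbol, i.e. $+1$ if $\det C'=1$ and $-1$ if $\det C'=-1$ in $\mathbb F_3$), where $C'$ is any principal $\rho\times\rho$ submatrix of $C$ with nonzero determinant; if $C=0$, $\operatorname{sign}(C)=1$. *)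

(* Defs.v *)
From HB Require Import structures.
From mathcomp Require Import all_boot all_order all_algebra all_fingroup.

Set Implicit Arguments.
Unset Strict Implicit.
Unset Printing Implicit Defensive.

Import GRing.Theory.
Local Open Scope ring_scope.

Record sgraph := SGraph {
  vertex :> finType;
  adj : rel vertex;
  adj_sym : symmetric adj;
  adj_irr : irreflexive adj
}.

Section Graph.
Variable G : sgraph.

Definition edges : {set {set G}} :=
  [set [set p.1; p.2] | p in [pred p : G * G | adj p.1 p.2]].

Definition cubic : Prop := forall x : G, #|[set y | adj x y]| = 3%N.

Definition connected_graph : Prop := forall x y : G, connect (@adj G) x y.

Definition adj_minus (v : G) : rel G :=
  [rel x y | [&& adj x y, x != v & y != v]].

Definition cut_vertex (v : G) : Prop :=
  exists x y : G, [/\ x != v, y != v & ~~ connect (adj_minus v) x y].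

Definition biconnected : Prop :=
  connected_graph /\ forall v : G, ~ cut_vertex v.

Definition edge := {A : {set G} | A \in edges}.

Definition is_tait_coloring (c : {ffun edge -> 'I_3}) : bool :=
  [forall A : edge, forall B : edge,
    (A != B) && (val A :&: val B != set0) ==> (c A != c B)].

Definition tait_colorings : {set {ffun edge -> 'I_3}} :=
  [set c | is_tait_coloring c].

(* A dart is an edge with an orientation; [rev] turns the orientation over. *)
Definition dart := {p : G * G | adj p.1 p.2}.

Definition dtail (d : dart) : G := (val d).1.

Fact rev_subproof (d : dart) : adj (val d).2 (val d).1.
Proof. by rewrite adj_sym; apply: valP d. Qed.

Definition rev (d : dart) : dart :=
  exist (fun p : G * G => adj p.1 p.2) ((val d).2, (val d).1) (rev_subproof d).

Lemma revK : involutive rev.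
Proof. by move=> d; apply: val_inj; case: d => [[]]. Qed.

Definition rev_perm : {perm dart} := perm (inv_inj revK).

(* Embeddings are given combinatorially, by the cyclic order of the darts     *)
(* around every vertex: the cycles of [s] are the sets of darts with a common *)
(* tail.                                                                      *)
Definition rotation_system (s : {perm dart}) : Prop :=
  forall d : dart, porbit s d = [set d' | dtail d' == dtail d].

(* Tracing a face: cross the current edge, then turn to the next dart around  *)
(* the vertex reached.  Permutations compose from left to right, so this      *)
(* maps [d] to [s (rev d)].                                                   *)
Definition face_perm (s : {perm dart}) : {perm dart} := (rev_perm * s)%g.

Definition faces (s : {perm dart}) : {set {set dart}} := porbits (face_perm s).

(* For a connected graph with an edge, the surface carrying the rotation      *)
(* system is the sphere (equivalently, after puncturing a face, the plane)    *)
(* exactly when V - E + F = 2.                                                *)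
Definition plane_embedding (s : {perm dart}) : Prop :=
  rotation_system s /\ (#|G| + #|faces s| = #|edges| + 2)%N.

Definition on_face (v : G) (F : {set dart}) : bool :=
  [exists d in F, dtail d == v].

Definition FM m (F : 'I_m -> {set dart}) (alpha : {ffun G -> 'F_3}) :
    'M['F_3]_m :=
  \matrix_(i, j) \sum_(v : G | on_face v (F i) && on_face v (F j)) alpha v.

End Graph.

Definition legendre3 (x : 'F_3) : rat :=
  if x == 0 then 0 else if x == 1 then 1 else -1.

Definition principal_submx m (C : 'M['F_3]_m) (J : {set 'I_m}) :
    'M['F_3]_#|J| :=
  mxsub enum_val enum_val C.

Definition full_minor m (C : 'M['F_3]_m) (J : {set 'I_m}) : bool :=
  (#|J| == \rank C) && (\det (principal_submx C J) != 0).

(* [full_minor_ex] and [mxsignE] show that, for a symmetric matrix, a suitable *)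
(* [J] exists and the sign does not depend on its choice.                      *)
Definition mxsign m (C : 'M['F_3]_m) : rat :=
  if C == 0 then 1 else
  if [pick J | full_minor C J] is Some J
  then legendre3 (\det (principal_submx C J)) else 1.

Lemma full_minor_ex m (C : 'M['F_3]_m) :
  C^T = C -> exists J : {set 'I_m}, full_minor C J.
Proof.
move=> symC; pose f := maxrankfun C; pose J := [set f i | i : 'I_(\rank C)].
have cardJ : #|J| = \rank C by rewrite card_imset ?card_ord //; apply: maxrankfun_inj.
exists J; apply/andP; split; first exact/eqP.
pose A := rowsub (@enum_val _ (mem J)) C.
have sCA : (C <= A)%MS.
  rewrite -(eq_maxrowsub C); apply/row_subP => i.
  have fiJ : f i \in J by apply: imset_f.
  rewrite row_rowsub -/f -(enum_rankK_in fiJ fiJ) -row_rowsub.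
  exact: row_sub.
have [P defC] := submxP sCA.
have defA : A = principal_submx C J *m P^T.
  have {1}-> : A = rowsub (@enum_val _ (mem J)) (A^T *m P^T).
    by rewrite -trmx_mul -defC symC.
  rewrite -mul_rowsub_mx; congr (_ *m _).
  by apply/matrixP=> i j; rewrite !mxE -{1}symC mxE.
have rkA : (#|J| <= \rank A)%N by rewrite [leqLHS]cardJ mxrankS.
have : row_full (principal_submx C J).
  rewrite -col_leq_rank (leq_trans rkA) // {1}defA; exact: mxrankM_maxl.
by rewrite row_full_unit unitmxE unitfE.
Qed.

Lemma sqr_F3 (x : 'F_3) : x != 0 -> x ^+ 2 = 1.
Proof. by case: x => [[|[|[|]]]] // ? _; apply/val_inj. Qed.

Lemma det_mxsub_full m (C : 'M['F_3]_m) k l (f : 'I_k -> 'I_m) (g : 'I_l -> 'I_m) :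
  C^T = C -> k = \rank C -> l = \rank C ->
  \det (mxsub f f C) != 0 -> \det (mxsub g g C) != 0 ->
  \det (mxsub f f C) = \det (mxsub g g C).
Proof.
move=> symC rk eq_l; have eq_lk : l = k by rewrite eq_l.
case: k / eq_lk f rk => f rk {eq_l} nzf nzg.
have rkf : \rank (mxsub f f C) = l.
  by apply: mxrank_unit; rewrite unitmxE unitfE.
have sfC : (rowsub f C <= C)%MS by apply: rowsub_sub.
have sCf : (C <= rowsub f C)%MS.
  rewrite -(geq_leqif (mxrank_leqif_sup sfC)) -rk -{1}rkf.
  have -> : mxsub f f C = rowsub f C *m colsub f 1%:M.
    by rewrite mulmx_colsub mulmx1; apply/matrixP=> i j; rewrite !mxE.
  exact: mxrankM_maxl.
have [P defg] := submxP (submx_trans (rowsub_sub g C) sCf).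
have subE h : mxsub g h C = P *m mxsub f h C.
  have -> : mxsub g h C = colsub h (rowsub g C) by apply/matrixP=> i j; rewrite !mxE.
  rewrite defg -mulmx_colsub; congr (_ *m _).
  by apply/matrixP=> i j; rewrite !mxE.
have trE : mxsub f g C = (mxsub g f C)^T.
  by apply/matrixP=> i j; rewrite !mxE -{1}symC mxE.
have symf : (mxsub f f C)^T = mxsub f f C.
  by apply/matrixP=> i j; rewrite !mxE -{1}symC mxE.
have detE : \det (mxsub g g C) = \det P ^+ 2 * \det (mxsub f f C).
  by rewrite subE trE subE trmx_mul symf !det_mulmx det_tr mulrCA -expr2 mulrC.
rewrite detE sqr_F3 ?mul1r //; apply: contraNneq nzg => P0.
by rewrite detE P0 expr0n mul0r.
Qed.

Lemma mxsignE m (C : 'M['F_3]_m) (J : {set 'I_m}) :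
  C^T = C -> C != 0 -> full_minor C J ->
  mxsign C = legendre3 (\det (principal_submx C J)).
Proof.
move=> symC /negPf nzC fJ; rewrite /mxsign nzC; case: pickP => [K fK|/(_ J)].
  case/andP: fJ fK => /eqP cJ nJ /andP[/eqP cK nK].
  by congr legendre3; apply: det_mxsub_full.
by rewrite fJ.
Qed.

(* Main.v *)
Require Import Defs.
From mathcomp Require Import all_boot all_order all_algebra all_fingroup.
From mathcomp Require Import all_field ring zify.

Set Implicit Arguments.
Unset Strict Implicit.
Unset Printing Implicit Defensive.

Import Order.TTheory GRing.Theory Num.Theory.
Local Open Scope ring_scope.

(* Both sides count three times the Heawood vertex labellings: the            *)
(* [e : V -> {-1, 1}] whose sum over the vertices of every face vanishes in   *)
(* F_3.                                                                       *)
(*   Let w be a primitive cube root of unity and s_v(x) the sum of x_i over   *)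
(* the faces F_i through v.  The Gauss sum of w ^ (x FM(alpha) x^T) over x is *)
(* 3 ^ m * ((1 + 2 w) / 3) ^ rank * sign, with (1 + 2 w) ^ 2 = -3.  Summed    *)
(* over alpha it becomes the sum over x of the product over v of              *)
(* w ^ (s_v ^ 2) + w ^ (- s_v ^ 2) = w ^ s_v + w ^ (- s_v), which is 3 ^ m    *)
(* times the number of Heawood labellings.  The odd ranks carry an irrational *)
(* factor, so they contribute 0.                                              *)
(*   A Tait coloring with colors in F_3 yields a Heawood labelling, the       *)
(* constant difference of successive colors around each vertex.  Conversely a *)
(* Heawood labelling is a cocycle on the medial graph, and on a sphere it     *)
(* integrates to a coloring, unique up to an additive constant.               *)

(** * Cocycles on a combinatorial sphere *)

(** The two sides meet at the number of Heawood labellings: [signed_rank_sum] evaluates the sum over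
    [alpha], and [card_tait] counts the colorings. The first half rests on [gauss_sign]: modulo its
    radical, a symmetric form over F_3 is given by a nondegenerate principal minor, whose Gauss sum
    follows by splitting off one square at a time. The bridge from quadratic to linear exponents is
    [chi_sqr], after which orthogonality of characters detects the vanishing of all face sums. The
    second half rests on the vanishing of the first cohomology of the sphere, obtained in
    [exact_of_euler] by counting ranks against Euler's formula and applied to darts in
    [plane_cocycle]. Biconnectedness enters through [rot_notin_face]: a face visits no vertex twice,
    so sums over the vertices of a face, as in [FM], are sums along its boundary walk. The factor 3
    is the free choice of the color of one edge. *)

Lemma rank_of_line_kernel (K : fieldType) m n (M : 'M[K]_(m, n)) (i0 : 'I_m) :
  (forall v : 'rV_m, v *m M = 0 -> v 0 i0 = 0 -> v = 0) -> (m <= \rank M + 1)%N.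
Proof.
(* The extra column reads coordinate [i0]: it makes the rows independent and raises the rank by at
   most one. *)
move=> kerM; pose N := row_mx M (delta_mx i0 (0 : 'I_1)).
have freeN : row_free N.
  apply: inj_row_free => v; rewrite mul_mx_row -row_mx0 => /eq_row_mx[vM /matrixP/(_ 0 0)].
  rewrite -colE !mxE => v0; exact: kerM.
rewrite -row_leq_rank in freeN; apply: leq_trans freeN _.
rewrite -mxrank_tr tr_row_mx -addsmxE -(mxrank_tr M).
by rewrite (leq_trans (mxrank_adds_leqif _ _)) // leq_add2l rank_leq_row.
Qed.

(** Both end kernels have dimension at most one, so the left kernel of [B] has dimension at most q -
    (r - 1) = p - 1, which is at most the rank of [A]; since it contains the image of [A], the two
    coincide. *)
Lemma exact_of_euler (K : fieldType) p q r (A : 'M[K]_(p, q)) (B : 'M[K]_(q, r))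
    (i0 : 'I_p) (k0 : 'I_r) (v : 'rV_q) :
  (p + r = q + 2)%N -> A *m B = 0 ->
  (forall u : 'rV_p, u *m A = 0 -> u 0 i0 = 0 -> u = 0) ->
  (forall u : 'cV_r, B *m u = 0 -> u k0 0 = 0 -> u = 0) ->
  v *m B = 0 -> (v <= A)%MS.
Proof.
move=> euler AB /rank_of_line_kernel rA kerB vB.
have rB : (r <= \rank B + 1)%N.
  rewrite -mxrank_tr; apply: (@rank_of_line_kernel _ _ _ _ k0) => u uB u0.
  rewrite -[u]trmxK (kerB u^T) ?trmx0 ?mxE //.
  by rewrite -[B]trmxK -trmx_mul uB trmx0.
have sAB : (A <= kermx B)%MS by apply/sub_kermxP.
move/sub_kermxP: vB => /submx_trans; apply.
rewrite -(geq_leqif (mxrank_leqif_sup sAB)) mxrank_ker; lia.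
Qed.

Lemma exact_of_euler_fin (K : fieldType) (X Y Z : finType)
    (A : X -> Y -> K) (B : Y -> Z -> K) (x0 : X) (z0 : Z) (phi : Y -> K) :
  (#|X| + #|Z| = #|Y| + 2)%N ->
  (forall x z, \sum_y A x y * B y z = 0) ->
  (forall c : X -> K, (forall y, \sum_x c x * A x y = 0) -> c x0 = 0 -> forall x, c x = 0) ->
  (forall g : Z -> K, (forall y, \sum_z B y z * g z = 0) -> g z0 = 0 -> forall z, g z = 0) ->
  (forall z, \sum_y phi y * B y z = 0) ->
  exists c : X -> K, forall y, \sum_x c x * A x y = phi y.
Proof.
move=> euler AB kerA kerB phiB.
have enumE (T : finType) (f : T -> K) : \sum_(i < #|T|) f (enum_val i) = \sum_t f t.
  by rewrite [RHS](reindex _ (onW_bij _ (enum_val_bij T))).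
pose MA := \matrix_(i < #|X|, j < #|Y|) A (enum_val i) (enum_val j).
pose MB := \matrix_(i < #|Y|, j < #|Z|) B (enum_val i) (enum_val j).
have : (\row_(j < #|Y|) phi (enum_val j) <= MA)%MS.
  apply: (@exact_of_euler _ _ _ _ MA MB (enum_rank x0) (enum_rank z0) _ euler).
  - apply/matrixP => i k; rewrite !mxE -[RHS](AB (enum_val i) (enum_val k)) -[RHS]enumE.
    by apply: eq_bigr => j _; rewrite !mxE.
  - move=> u uA u0; apply/rowP => i; rewrite mxE -[i]enum_valK.
    apply: (kerA (fun x => u 0 (enum_rank x))) => // y.
    have /rowP/(_ (enum_rank y)) := uA; rewrite !mxE => uAy; rewrite -[RHS]uAy -[LHS]enumE.
    by apply: eq_bigr => j _; rewrite !mxE enum_valK enum_rankK.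
  - move=> u uB u0; apply/colP => i; rewrite mxE -[i]enum_valK.
    apply: (kerB (fun z => u (enum_rank z) 0)) => // y.
    have /colP/(_ (enum_rank y)) := uB; rewrite !mxE => uBy; rewrite -[RHS]uBy -[LHS]enumE.
    by apply: eq_bigr => j _; rewrite !mxE enum_valK enum_rankK.
  apply/rowP => k; rewrite !mxE -[RHS](phiB (enum_val k)) -[RHS]enumE.
  by apply: eq_bigr => j _; rewrite !mxE.
case/submxP => u /rowP uA; exists (fun x => u 0 (enum_rank x)) => y.
have := uA (enum_rank y); rewrite !mxE enum_rankK => ->; rewrite -[LHS]enumE.
by apply: eq_bigr => j _; rewrite !mxE enum_valK enum_rankK.
Qed.

(** Orbits are packaged in a sigma type so that the 2-cells form a [finType] and can index sums. *)
Definition in_orbit (T : finType) (p : {perm T}) (o : {O : {set T} | O \in porbits p}) (x : T) :=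
  x \in val o.

Definition orbit_of (T : finType) (p : {perm T}) (x : T) : {O : {set T} | O \in porbits p} :=
  exist _ (porbit p x) (imset_f (porbit p) (isT : x \in T)).

Lemma orbit_ofP (T : finType) (p : {perm T}) (O : {O : {set T} | O \in porbits p}) :
  exists x, O = orbit_of p x.
Proof. by case: O => O pO; have /imsetP[x _ defO] := pO; exists x; apply: val_inj. Qed.

Lemma mem_orbit_of (T : finType) (p : {perm T}) (O : {O : {set T} | O \in porbits p}) x :
  in_orbit O x = (O == orbit_of p x).
Proof. by have [y ->] := orbit_ofP O; rewrite /in_orbit -val_eqE /= eq_sym eq_porbit_mem. Qed.

Lemma orbit_of_perm (T : finType) (p : {perm T}) x : orbit_of p (p x) = orbit_of p x.
Proof. by apply: val_inj; have := porbit_perm p 1 x; rewrite expg1. Qed.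

Lemma sum_orbit_of (K : fieldType) (T : finType) (p : {perm T})
    (g : {O : {set T} | O \in porbits p} -> K) x :
  \sum_(O : {O : {set T} | O \in porbits p}) (in_orbit O x)%:R * g O = g (orbit_of p x).
Proof.
rewrite (bigD1 (orbit_of p x)) //= mem_orbit_of eqxx mul1r big1 ?addr0 // => O.
by rewrite mem_orbit_of => /negPf ->; rewrite mul0r.
Qed.

Lemma sum_delta (K : fieldType) (T : finType) (g : T -> K) x : \sum_y g y * (y == x)%:R = g x.
Proof.
rewrite (bigD1 x) //= eqxx mulr1 big1 ?addr0 // => y /negPf ->.
by rewrite mulr0.
Qed.

(* The orbit count is Euler's formula for the complex with vertex set [D], an  *)
(* edge from [x] to [a x] and one to [b x] for every [x], and a 2-cell for     *)
(* every orbit of [a], [b] and [a * b].                                        *)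
Lemma genus0_cocycle (K : fieldType) (D : finType) (a b : {perm D}) (phi psi : D -> K) (x0 : D) :
  (forall g : D -> K, (forall x, g (a x) = g x) -> (forall x, g (b x) = g x) ->
     forall x, g x = g x0) ->
  (#|porbits a| + #|porbits b| + #|porbits (a * b)%g| = #|D| + 2)%N ->
  (forall x, \sum_(y in porbit a x) phi y = 0) ->
  (forall x, \sum_(y in porbit b x) psi y = 0) ->
  (forall x, \sum_(y in porbit (a * b)%g x) (phi y + psi (a y)) = 0) ->
  exists c : D -> K,
    (forall x, c (a x) = c x + phi x) /\ (forall x, c (b x) = c x + psi x).
Proof.
move=> trans euler phi0 psi0 pp0; set ab := (a * b)%g in euler pp0.
pose Z : finType := ({o : {set D} | o \in porbits a} + {o : {set D} | o \in porbits b}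
  + {o : {set D} | o \in porbits ab})%type.
pose A (x : D) (y : D + D) : K :=
  match y with inl y => (x == a y)%:R - (x == y)%:R | inr y => (x == b y)%:R - (x == y)%:R end.
(* The boundary of an [a * b] cell follows, from each [x] in the orbit, the [a]-edge at [x] and then
   the [b]-edge at [a x]; hence the [b]-edge at [y] is on the cell of [a^-1 y]. *)
pose B (y : D + D) (z : Z) : K :=
  match y, z with
  | inl y, inl (inl o) => (in_orbit o y)%:R
  | inr y, inl (inr o) => (in_orbit o y)%:R
  | inl y, inr o => (in_orbit o y)%:R
  | inr y, inr o => (in_orbit o (a^-1%g y))%:R
  | _, _ => 0
  end.
pose phipsi y := match y with inl y => phi y | inr y => psi y end.
have AE c y : \sum_x c x * A x y =
    match y with inl y => c (a y) - c y | inr y => c (b y) - c y end.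
  by case: y => y; under eq_bigr do rewrite /A mulrBr; rewrite sumrB !sum_delta.
have deltaE (p : {perm D}) (h : D -> K) x :
    \sum_y ((x == p y)%:R - (x == y)%:R) * h y = h ((p^-1)%g x) - h x.
  under eq_bigr do rewrite mulrBl.
  rewrite sumrB; congr (_ - _).
    rewrite -[RHS]sum_delta; apply: eq_bigr => y _.
    by rewrite mulrC [x == _]eq_sym (canF_eq (permK p)).
  by rewrite -[RHS]sum_delta; apply: eq_bigr => y _; rewrite mulrC eq_sym.
have memV (p : {perm D}) (o : {o : {set D} | o \in porbits p}) x :
    in_orbit o (p^-1%g x) = in_orbit o x.
  by rewrite !mem_orbit_of -(orbit_of_perm p (p^-1%g x)) permKV.
have [//|x z|c cA c0 x|g gB g0 z|z|c cE] :=
  @exact_of_euler_fin K D (D + D)%type Z A B x0 (inr (orbit_of ab x0)) phipsi.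
- by rewrite !card_sum !card_sig euler; lia.
- rewrite big_sumType /=; case: z => [[o|o]|o].
  + rewrite deltaE /= memV subrr add0r big1 // => y _; exact: mulr0.
  + rewrite [X in X + _]big1 ?add0r => [|y _]; last exact: mulr0.
    by rewrite deltaE memV subrr.
  rewrite deltaE (deltaE b (fun y => (in_orbit o (a^-1%g y))%:R)) addrC subrKA.
  by rewrite -[in_orbit o x]memV invMg permM subrr.
- rewrite (trans c) // => y; apply/eqP; rewrite -subr_eq0.
    by have := cA (inl y); rewrite AE => ->.
  by have := cA (inr y); rewrite AE => ->.
(* Every edge borders one [a * b] cell and one cell of [a] or [b], so a 2-cycle takes opposite
   values on them. Thus [G] is constant on the orbits of [a] and [b], and one zero value kills the
   whole cycle. *)
- pose G x := g (inr (orbit_of ab x)).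
  have BE y : \sum_z B y z * g z = match y with
      | inl y => g (inl (inl (orbit_of a y))) + G y
      | inr y => g (inl (inr (orbit_of b y))) + G (a^-1%g y) end.
    rewrite !big_sumType /=; case: y => y /=.
      rewrite (sum_orbit_of (fun o => g (inl (inl o)))) (sum_orbit_of (fun o => g (inr o))).
      by rewrite big1 ?addr0 // => o _; rewrite mul0r.
    rewrite (sum_orbit_of (fun o => g (inl (inr o)))) (sum_orbit_of (fun o => g (inr o))).
    by rewrite big1 ?add0r // => o _; rewrite mul0r.
  have gl y : g (inl (inl (orbit_of a y))) = - G y.
    by apply/eqP; rewrite -addr_eq0; have := gB (inl y); rewrite BE => ->.
  have gr y : g (inl (inr (orbit_of b y))) = - G (a^-1%g y).
    by apply/eqP; rewrite -addr_eq0; have := gB (inr y); rewrite BE => ->.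
  have Ga y : G (a y) = G y by apply: oppr_inj; rewrite -!gl orbit_of_perm.
  have Gb y : G (b y) = G y.
    by apply: oppr_inj; rewrite -(permKV a (b y)) -{2}(permKV a y) !Ga -!gr orbit_of_perm.
  have G0 y : G y = 0 by rewrite (trans G).
  case: z => [[o|o]|o]; have [y ->] := orbit_ofP o.
  + by rewrite gl G0 oppr0.
  + by rewrite gr G0 oppr0.
  + exact: G0.
- rewrite big_sumType /=.
  have indE (h : D -> K) (P : pred D) : \sum_y h y * (P y)%:R = \sum_(y | P y) h y.
    by rewrite [RHS]big_mkcond; apply: eq_bigr => y _; case: (P y); rewrite ?mulr1 ?mulr0.
  case: z => [[o|o]|o]; have [x ->] := orbit_ofP o => /=.
  + by rewrite indE phi0 big1 ?addr0 // => y _; rewrite mulr0.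
  + by rewrite (indE psi) psi0 big1 ?addr0 // => y _; rewrite mulr0.
  rewrite indE [X in _ + X](reindex_inj (@perm_inj _ a)) /=.
  under [X in _ + X]eq_bigr do rewrite permK.
  by rewrite (indE (fun y => psi (a y))) -big_split pp0.
exists c; split=> x.
  by have := cE (inl x); rewrite AE /= => /eqP; rewrite subr_eq addrC => /eqP.
by have := cE (inr x); rewrite AE /= => /eqP; rewrite subr_eq addrC => /eqP.
Qed.

(** * Gauss sums over F_3 *)

Lemma cube_root_unity : exists w : algC, 1 + w + w ^+ 2 = 0.
Proof.
have [w w3] := C_prim_root_exists (isT : (0 < 3)%N).
exists w; apply/eqP; have := prim_expr_order w3 => /eqP; rewrite -subr_eq0.
have -> : w ^+ 3 - 1 = (w - 1) * (1 + w + w ^+ 2) by ring.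
rewrite mulf_eq0 subr_eq0 => /orP[/eqP w1 | //].
by have := prim_order_dvd w3 1; rewrite expr1 w1 eqxx.
Qed.

(** For a primitive cube root of unity [w], this is the additive character of F_3 sending 1 to [w];
    the exponent is the natural representative of [t]. *)
Definition chi (w : algC) (t : 'F_3) : algC := w ^+ t.

Lemma F3P (t : 'F_3) : [\/ t = 0, t = 1 | t = -1].
Proof.
by case: t => [[|[|[|//]]]] lt_t; [apply: Or31|apply: Or32|apply: Or33]; apply: val_inj.
Qed.

Lemma chi0 (w : algC) : chi w 0 = 1.
Proof. by []. Qed.

Lemma chiD (w : algC) s t : 1 + w + w ^+ 2 = 0 -> chi w (s + t) = chi w s * chi w t.
Proof.
move=> w0; have w3 : w ^+ 3 = 1.
  by rewrite (_ : w ^+ 3 = 1 + (w - 1) * (1 + w + w ^+ 2)); [rewrite w0 mulr0 addr0 | ring].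
by rewrite /chi /= -exprD (expr_mod _ w3).
Qed.

Lemma chi_sum (w : algC) (I : finType) (f : I -> 'F_3) : 1 + w + w ^+ 2 = 0 ->
  chi w (\sum_i f i) = \prod_i chi w (f i).
Proof.
by move=> w0; apply: (big_morph (chi w)) => [s t|]; [apply: chiD | apply: chi0].
Qed.

Lemma sum_F3 (f : 'F_3 -> algC) : \sum_t f t = f 0 + f 1 + f (-1).
Proof.
rewrite (bigD1 0) // (bigD1 1) // (bigD1 (-1)) //= big1 ?addr0 ?addrA // => t.
by case: (F3P t) => ->.
Qed.

Definition quad m (C : 'M['F_3]_m) (x : 'rV_m) : 'F_3 := (x *m C *m x^T) 0 0.

Definition gauss w m (C : 'M['F_3]_m) : algC := \sum_x chi w (quad C x).

Lemma quad_congr m k (P : 'M_(m, k)) (C : 'M_k) x : quad (P *m C *m P^T) x = quad C (x *m P).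
Proof. by rewrite /quad trmx_mul !mulmxA. Qed.

Lemma gauss_congr w m (A C : 'M_m) : A \in unitmx -> gauss w (A *m C *m A^T) = gauss w C.
Proof.
move=> uA; rewrite [RHS](reindex_onto (fun x => x *m A) (fun x => x *m invmx A)) /=.
  by apply: eq_big => x; rewrite ?mulmxK ?eqxx // quad_congr.
by move=> x _; rewrite mulmxKV.
Qed.

Lemma gauss_block w m n (C : 'M_m) (D : 'M_n) : 1 + w + w ^+ 2 = 0 ->
  gauss w (block_mx C 0 0 D) = gauss w C * gauss w D.
Proof.
move=> w0; rewrite /gauss big_distrlr pair_big /=.
rewrite (reindex (fun p : 'rV_m * 'rV_n => row_mx p.1 p.2)) /=; last first.
  exists (fun x => (lsubmx x, rsubmx x)) => [[x y] _|x _]; last exact: hsubmxK.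
  by rewrite row_mxKl row_mxKr.
apply: eq_bigr => -[x y] _ /=; rewrite -chiD // /quad tr_row_mx mul_row_block.
by rewrite !mulmx0 addr0 add0r mul_row_col mxE.
Qed.

(** The square map takes 0 once and 1 twice, so the sum is 1 + 2 w for a = 1, and 1 + 2 w^2 = - (1 +
    2 w) for a = -1. *)
Lemma gauss_dim1 w (a : 'F_3) : 1 + w + w ^+ 2 = 0 -> a != 0 ->
  gauss w (a%:M : 'M_1) = (1 + 2 * w) * ratr (legendre3 a).
Proof.
move=> w0 nz_a; rewrite /gauss (reindex (fun t : 'F_3 => t%:M)) /=; last first.
  by exists (fun x : 'rV_1 => x 0 0) => [t _|x _]; rewrite ?mxE // -mx11_scalar.
have qE (t : 'F_3) : quad a%:M t%:M = a * t ^+ 2.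
  by rewrite /quad tr_scalar_mx -!scalar_mxM mxE expr2 mulrCA mulrA.
under eq_bigr do rewrite qE.
rewrite sum_F3 expr0n mulr0 chi0 sqrrN expr1n mulr1 /legendre3 (negPf nz_a).
case: (F3P a) nz_a => -> //= _; rewrite ?rmorph1 ?rmorphN ?rmorph1; first by rewrite /chi /=; ring.
rewrite /chi /= [LHS](_ : _ = 2 * (1 + w + w ^+ 2) - (1 + 2 * w)); last by ring.
by rewrite w0 mulr0 sub0r mulrN1.
Qed.

Lemma quadZ m (C : 'M_m) c x : quad C (c *: x) = c ^+ 2 * quad C x.
Proof. by rewrite /quad linearZ /= -!scalemxAl -scalemxAr scalerA mxE. Qed.

Lemma quad_delta m (C : 'M_m) i : quad C (delta_mx 0 i) = C i i.
Proof. by rewrite /quad trmx_delta -rowE -colE !mxE. Qed.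

(** Polarization: if the form vanishes everywhere, then 2 C_ij = 0 for all i and j, and 2 is
    invertible in F_3. *)
Lemma sym_anisotropic m (C : 'M['F_3]_m) :
  C^T = C -> C != 0 -> exists u, quad C u != 0.
Proof.
move=> symC nzC; apply/existsP; apply: contraNT nzC => /existsPn noq.
apply/eqP/matrixP => i j; rewrite mxE.
have q0 u : quad C u = 0 by apply/eqP; have /negPn := noq u.
have bE i' j' : (delta_mx 0 i' *m C *m (delta_mx 0 j')^T : 'M_1) 0 0 = C i' j'.
  by rewrite trmx_delta -rowE -colE !mxE.
have := q0 (delta_mx 0 i + delta_mx 0 j).
have addE (A B : 'M['F_3]_1) : (A + B) 0 0 = A 0 0 + B 0 0 by rewrite mxE.
rewrite /quad linearD /= mulmxDl mulmxDr !mulmxDl !addE.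
have symCij : C j i = C i j by rewrite -[in LHS]symC mxE.
have Cii k : C k k = 0 by rewrite -bE; apply: q0.
by rewrite !bE !Cii symCij add0r addr0; case: (F3P (C i j)) => ->.
Qed.

(** Completing the square in the first variable. *)
Lemma schur_congr m (a : 'F_3) (b : 'rV_m) (d : 'M_m) : a != 0 ->
  let L := block_mx (1%:M : 'M_1) 0 (- a^-1 *: b^T) 1%:M in
  L *m block_mx a%:M b b^T d *m L^T = block_mx a%:M 0 0 (d - a^-1 *: (b^T *m b)).
Proof.
move=> nz_a /=; rewrite tr_block_mx !trmx1 trmx0 linearZ /= trmxK !mulmx_block.
rewrite !mul1mx !mulmx1 !mul0mx !mulmx0 !addr0.
rewrite mul_mx_scalar scalerA mulrN mulfV // scaleN1r addNr mul0mx add0r.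
by rewrite mul_scalar_mx scalerA mulrN mulfV // scaleN1r addNr -scalemxAl scaleNr addrC.
Qed.

(** Induction on the dimension: an anisotropic vector becomes, up to a scalar, the first basis
    vector, and the Schur complement splits off a one-dimensional form. *)
Lemma gauss_unit w m (C : 'M['F_3]_m) : 1 + w + w ^+ 2 = 0 -> C^T = C -> \det C != 0 ->
  gauss w C = (1 + 2 * w) ^+ m * ratr (legendre3 (\det C)).
Proof.
move=> w0; elim: m C => [|m IHm] C symC detC.
  rewrite det_mx00 /legendre3 /= rmorph1 mulr1 expr0 /gauss.
  rewrite (bigD1 0) //= big1 => [|x]; last by rewrite [x]thinmx0 eqxx.
  by rewrite addr0 /quad !mul0mx mxE.
have [u qu] : exists u, quad C u != 0.
  by apply: sym_anisotropic => //; apply: contraNneq detC => ->; rewrite det0.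
(* An invertible matrix whose first row is proportional to [u]. *)
pose A := row_ebase u; have uA : A \in unitmx by apply: row_ebase_unit.
have nzu : u != 0 by apply: contraNneq qu => ->; rewrite /quad !mul0mx mxE.
have uE : u = col_ebase u 0 0 *: row 0 A.
  rewrite -{1}[u]mulmx_ebase rank_rV nzu [col_ebase u in LHS]mx11_scalar mul_scalar_mx.
  rewrite -scalemxAl rowE; congr (_ *: (_ *m _)); apply/matrixP => i j.
  by rewrite !mxE (ord1 i); case: j => [[|j] ?].
pose D : 'M_(1 + m) := A *m C *m A^T.
have symD : D^T = D by rewrite !trmx_mul trmxK symC mulmxA.
pose a := D 0 0.
have nz_a : a != 0.
  apply: contraNneq qu => a0; rewrite uE quadZ rowE -quad_congr.
  by rewrite (quad_delta D) -/a a0 mulr0.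
pose b := ursubmx D; pose d := drsubmx D.
have defD : D = block_mx a%:M b b^T d.
  rewrite -[D]submxK; congr block_mx.
    rewrite [ulsubmx D]mx11_scalar; congr (_%:M); rewrite ulsubmxEsub mxE.
    by congr (D _ _); apply: val_inj.
  by rewrite /b trmx_ursub symD.
pose L := block_mx (1%:M : 'M_1) 0 (- a^-1 *: b^T) (1%:M : 'M_m).
have detL : \det L = 1 by rewrite det_lblock !det1 mulr1.
have uL : L \in unitmx by rewrite unitmxE detL unitr1.
pose S := d - a^-1 *: (b^T *m b).
have schur : L *m D *m L^T = block_mx a%:M 0 0 S by rewrite defD schur_congr.
have detS : \det C = a * \det S.
  have := congr1 determinant schur.
  rewrite det_ublock det_scalar1 /D !det_mulmx !det_tr detL mul1r mulr1 => <-.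
  (* Congruence multiplies the determinant by the square of a unit, which is 1 in F_3. *)
  rewrite mulrAC -expr2 sqr_F3 ?mul1r //.
  by rewrite -unitfE -unitmxE.
have nzS : \det S != 0 by apply: contraNneq detC; rewrite detS => ->; rewrite mulr0.
have symS : S^T = S.
  by rewrite linearB linearZ /= trmx_mul trmxK /d trmx_drsub symD.
rewrite -(gauss_congr w C uA) -/D -(gauss_congr w D uL) schur gauss_block //.
rewrite gauss_dim1 // IHm // detS exprS mulrACA -rmorphM; congr (_ * ratr _).
by rewrite /legendre3; case: (F3P a) nz_a => ->; case: (F3P (\det S)) nzS => ->.
Qed.

Lemma sum_row_full m k (P : 'M['F_3]_(m, k)) (f : 'rV['F_3]_k -> algC) : row_full P ->
  \sum_(x : 'rV_m) f (x *m P) = 3 ^+ (m - k) * \sum_y f y.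
Proof.
move=> fullP; have [B BP] := row_fullP fullP.
have le_km : (k <= m)%N by rewrite -(eqP fullP) rank_leq_row.
(* All fibers of the surjection [x *m P] are cosets of its kernel. Their common size [N] is found at
   the end by summing the constant 1. *)
pose N : algC := \sum_(z : 'rV_m | z *m P == 0) 1.
have fibers (g : 'rV_k -> algC) : \sum_(x : 'rV_m) g (x *m P) = N * \sum_y g y.
  rewrite (partition_big (fun x => x *m P) xpredT) //= mulr_sumr.
  apply: eq_bigr => y _; rewrite mulr_suml (reindex_inj (addrI (y *m B))) /=.
  apply: eq_big => z; rewrite mulmxDl -mulmxA BP mulmx1.
    by rewrite -subr_eq0 [y + _]addrC addrK.
  by rewrite mul1r => /eqP ->.
have cardF p : \sum_(x : 'rV['F_3]_p) 1 = 3 ^+ p :> algC.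
  by rewrite sumr_const card_mx mul1n card_ord natrX.
rewrite fibers; congr (_ * _); have := fibers (fun=> 1); rewrite !cardF.
rewrite -{1}(subnK le_km) exprD => /mulIf -> //.
by rewrite expf_neq0 // pnatr_eq0.
Qed.

(** With [C'] a full principal minor, C = P C' P^T where [x *m P] is onto, so each value of the form
    [C'] is repeated 3 ^ (m - rank) times. *)
Lemma gauss_sign w m (C : 'M['F_3]_m) : 1 + w + w ^+ 2 = 0 -> C^T = C ->
  gauss w C = 3 ^+ (m - \rank C) * (1 + 2 * w) ^+ (\rank C) * ratr (mxsign C).
Proof.
move=> w0 symC; have [->|nzC] := eqVneq C 0.
  rewrite mxrank0 subn0 mulr1 /mxsign eqxx rmorph1 mulr1 /gauss.
  under eq_bigr do rewrite /quad mulmx0 mul0mx mxE chi0.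
  by rewrite sumr_const card_mx mul1n card_ord natrX.
have [J fJ] := full_minor_ex symC; rewrite (mxsignE symC nzC fJ).
have /andP[/eqP cardJ detJ] := fJ.
pose C' := principal_submx C J; pose A := rowsub (@enum_val _ (mem J)) C.
have symC' : C'^T = C' by apply/matrixP => i j; rewrite !mxE -{1}symC mxE.
have rkC' : \rank C' = #|J| by apply: mxrank_unit; rewrite unitmxE unitfE.
(* The rows indexed by [J] span all rows of [C], because their submatrix [C'] already has the rank
   of [C]. *)
have sCA : (C <= A)%MS.
  have sAC : (A <= C)%MS by apply: rowsub_sub.
  rewrite -(geq_leqif (mxrank_leqif_sup sAC)) -cardJ -[leqLHS]rkC'.
  have -> : C' = A *m colsub (@enum_val _ (mem J)) 1%:M.
    by rewrite mulmx_colsub mulmx1; apply/matrixP=> i j; rewrite !mxE.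
  exact: mxrankM_maxl.
have [P defC] := submxP sCA.
have defA : A = C' *m P^T.
  rewrite -symC' -trmx_mul; apply/matrixP => i j.
  have -> : P *m C' = colsub (@enum_val _ (mem J)) C.
    rewrite [in RHS]defC -mulmx_colsub; congr (_ *m _).
    by apply/matrixP=> i' j'; rewrite !mxE.
  by rewrite !mxE -[in LHS]symC mxE.
have fullP : row_full P.
  by rewrite -col_leq_rank [leqLHS]cardJ {1}defC mxrankM_maxl.
have {}defC : C = P *m C' *m P^T by rewrite -mulmxA -defA.
rewrite -cardJ -mulrA -(gauss_unit w0 symC') // -(sum_row_full (fun y => chi w (quad C' y)) fullP).
rewrite /gauss {1}defC.
by apply: eq_bigr => x _; rewrite quad_congr.
Qed.

Definition pm1 (V : finType) (e : {ffun V -> 'F_3}) := [forall v, (e v == -1) || (e v == 1)].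

Lemma sum_pm1 w (V : finType) (f : V -> 'F_3) : 1 + w + w ^+ 2 = 0 ->
  \sum_(e : {ffun V -> 'F_3} | pm1 e) chi w (\sum_v e v * f v)
    = \prod_v (chi w (f v) + chi w (- f v)).
Proof.
move=> w0; pose Q : pred 'F_3 := [pred t | (t == -1) || (t == 1)].
transitivity (\sum_(e in ffun_on Q) \prod_v chi w (e v * f v)).
  by apply: eq_big => [e|e _]; [apply/forallP/ffun_onP | rewrite chi_sum].
rewrite -(bigA_distr_big Q (fun v t => chi w (t * f v))).
apply: eq_bigr => v _; rewrite big_mkcond sum_F3 /= mul1r mulN1r.
by rewrite add0r.
Qed.

(** In F_3 the pairs {s^2, - s^2} and {s, - s} coincide; this turns the quadratic exponent into a
    linear one. *)
Lemma chi_sqr w s : chi w (s ^+ 2) + chi w (- s ^+ 2) = chi w s + chi w (- s).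
Proof. by case: (F3P s) => ->; rewrite ?expr0n ?sqrrN ?expr1n ?opprK // addrC. Qed.

(** Orthogonality of characters: if some [l i] is nonzero, translation by the i-th basis vector
    multiplies the sum by a factor other than 1. *)
Lemma sum_chi_linear w m (l : 'I_m -> 'F_3) : 1 + w + w ^+ 2 = 0 ->
  \sum_(x : 'rV_m) chi w (\sum_i x 0 i * l i) = 3 ^+ m * [forall i, l i == 0]%:R.
Proof.
move=> w0; have [/forallP l0|/forallPn[i li]] := boolP [forall i, l i == 0].
  under eq_bigr do [rewrite big1 ?chi0 => [|j _]; last by rewrite (eqP (l0 j)) mulr0].
  by rewrite sumr_const card_mx mul1n card_ord natrX mulr1.
rewrite mulr0; set S := LHS.
have chi_neq1 : chi w (l i) != 1.
  have w1 : chi w 1 != 1.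
    apply: contra_eqN w0 => /eqP; rewrite /chi expr1 => ->.
    by rewrite expr1n (_ : 1 + 1 + 1 = 3%:R :> algC) ?pnatr_eq0 //; ring.
  case: (F3P (l i)) li => -> // _; apply: contraNneq w1 => wN1.
  by have := chiD 1 (-1) w0; rewrite subrr chi0 wN1 mulr1 => <-.
have : S = chi w (l i) * S.
  rewrite mulr_sumr {1}/S (reindex_inj (addrI (delta_mx 0 i))) /=.
  apply: eq_bigr => x _; rewrite -chiD //; congr chi.
  under eq_bigr do rewrite !mxE mulrDl.
  rewrite big_split /= (bigD1 i) //= !eqxx mul1r big1 ?addr0 // => j /negPf.
  by rewrite eq_sym => ->; rewrite mul0r.
move/eqP; rewrite -subr_eq0 -{1}[S]mul1r -mulrBl mulf_eq0 subr_eq0 eq_sym (negPf chi_neq1).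
by move/eqP.
Qed.

(** The matrix is the sum over v of [alpha v] times the rank-one form of the incidence vector of
    v. *)
Lemma quad_incidence (V : finType) m (on : V -> 'I_m -> bool) (alpha : {ffun V -> 'F_3}) x :
  quad (\matrix_(i, j) \sum_(v | on v i && on v j) alpha v) x
    = \sum_v alpha v * (\sum_(i | on v i) x 0 i) ^+ 2.
Proof.
transitivity (\sum_j \sum_i \sum_v (on v i)%:R * (on v j)%:R * alpha v * x 0 i * x 0 j).
  rewrite /quad mxE; apply: eq_bigr => j _; rewrite !mxE mulr_suml; apply: eq_bigr => i _.
  rewrite mxE mulr_sumr mulr_suml big_mkcond; apply: eq_bigr => v _.
  by case: (on v i) (on v j) => [] []; rewrite ?(mul0r, mulr0) // !mul1r [x 0 i * _]mulrC.
under eq_bigr do rewrite exchange_big /=.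
rewrite exchange_big; apply: eq_bigr => v _ /=.
have onE : \sum_(i | on v i) x 0 i = \sum_i (on v i)%:R * x 0 i.
  by rewrite big_mkcond; apply: eq_bigr => i _; case: (on v i); rewrite ?mul1r ?mul0r.
rewrite onE expr2 mulrA mulr_sumr; apply: eq_bigr => j _.
by rewrite mulr_sumr mulr_suml; apply: eq_bigr => i _; ring.
Qed.

Lemma signed_rank_sum (V : finType) m (on : V -> 'I_m -> bool) :
  let M (alpha : {ffun V -> 'F_3}) := \matrix_(i, j) \sum_(v | on v i && on v j) alpha v in
  \sum_(alpha | pm1 alpha && ~~ odd (\rank (M alpha)))
    (- (1 / 3)) ^+ (\rank (M alpha))./2 * mxsign (M alpha)
  = #|[set e : {ffun V -> 'F_3} | pm1 e && [forall i, \sum_(v | on v i) e v == 0]]|%:R :> rat.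
Proof.
move=> M; have [w w0] := cube_root_unity.
set H := #|_|; pose T alpha : rat := (- (1 / 3)) ^+ (\rank (M alpha))./2 * mxsign (M alpha).
(* The Gauss sum per unit of rank, normalized by 3: a square root of -1/3. *)
pose eta : algC := (1 + 2 * w) / 3.
have nz3 : 3 != 0 :> algC by rewrite pnatr_eq0.
have eta2 : eta ^+ 2 = ratr (- (1 / 3)).
  have -> : eta ^+ 2 = - 3^-1 + 4 / 9 * (1 + w + w ^+ 2) by rewrite /eta; field.
  by rewrite w0 mulr0 addr0 div1r rmorphN /= fmorphV rmorph_nat.
have gaussM alpha : gauss w (M alpha) = 3 ^+ m * (eta ^+ odd (\rank (M alpha)) * ratr (T alpha)).
  have symM : (M alpha)^T = M alpha.
    by apply/matrixP => i j; rewrite !mxE; apply: eq_bigl => v; rewrite andbC.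
  rewrite gauss_sign // /T rmorphM rmorphXn /= -eta2 -exprM mul2n [eta ^+ _ * (_ * _)]mulrA -exprD.
  rewrite odd_double_half mulrA /eta expr_div_n; congr (_ * _).
  have -> : 3 ^+ m = 3 ^+ (m - \rank (M alpha)) * 3 ^+ \rank (M alpha) :> algC.
    by rewrite -exprD subnK // rank_leq_row.
  by rewrite -[RHS]mulrA [in RHS](mulrC (3 ^+ _) (_ / _)) divfK // expf_neq0.
have total : \sum_(alpha | pm1 alpha) gauss w (M alpha) = 3 ^+ m * H%:R.
  pose s x v := \sum_(i | on v i) (x : 'rV['F_3]_m) 0 i.
  transitivity (\sum_(e : {ffun V -> 'F_3} | pm1 e) \sum_(x : 'rV_m) chi w (\sum_v e v * s x v)).
    rewrite exchange_big [RHS]exchange_big; apply: eq_bigr => x _ /=.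
    under eq_bigr do rewrite quad_incidence.
    rewrite (sum_pm1 (fun v => s x v ^+ 2)) // sum_pm1 //.
    by apply: eq_bigr => v _; rewrite chi_sqr.
  rewrite /H -sum1_card natr_sum mulr_sumr big_mkcond [RHS]big_mkcond /=.
  apply: eq_bigr => e _; rewrite inE; case: (pm1 e) => //=.
  transitivity (\sum_(x : 'rV_m) chi w (\sum_i x 0 i * (\sum_(v | on v i) e v))).
    apply: eq_bigr => x _; congr chi; rewrite /s.
    under eq_bigr do rewrite mulr_sumr big_mkcond.
    rewrite exchange_big; apply: eq_bigr => i _; rewrite mulr_sumr [RHS]big_mkcond.
    by apply: eq_bigr => v _; case: (on v i); rewrite // mulrC.
  by rewrite sum_chi_linear //; case: ifP; rewrite ?mulr1 ?mulr0.
pose A := \sum_(alpha | pm1 alpha && ~~ odd (\rank (M alpha))) T alpha.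
pose B := \sum_(alpha | pm1 alpha && odd (\rank (M alpha))) T alpha.
rewrite -[LHS]/A; have : ratr (H%:R - A) = eta * ratr B.
  apply: (mulfI (expf_neq0 m nz3)); rewrite rmorphB rmorph_nat /= mulrBr -total.
  apply/eqP; rewrite subr_eq; apply/eqP.
  rewrite (bigID (fun alpha => odd (\rank (M alpha)))) /= /A /B !raddf_sum !mulr_sumr.
  congr (_ + _); apply: eq_bigr => alpha /andP[_ par]; rewrite gaussM.
    by rewrite par expr1.
  by rewrite (negPf par) mul1r.
(* Squaring gives (H - A)^2 = - B^2 / 3 between rationals; the left side is nonnegative and the
   right nonpositive, so both vanish. *)
move/(congr1 (fun z => z ^+ 2)); rewrite /= [RHS]exprMn eta2 -!rmorphXn /=.
rewrite -rmorphM => /fmorph_inj sq.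
apply/esym/eqP; rewrite -subr_eq0 -sqrf_eq0 eq_le sqr_ge0 andbT sq.
by rewrite mulNr oppr_le0 mulr_ge0 // sqr_ge0.
Qed.

(** * Tait colorings of a plane cubic graph *)

Lemma card_porbits_fibers (T U : finType) (p : {perm T}) (f : T -> U) :
  (forall x, porbit p x = [set y | f y == f x]) -> #|porbits p| = #|f @: T|.
Proof.
move=> fibE; have -> : porbits p = (fun u => [set y | f y == u]) @: (f @: T).
  by rewrite -imset_comp; apply: eq_imset => x; rewrite fibE.
apply: card_in_imset => _ _ /imsetP[x _ ->] /imsetP[y _ ->] /setP/(_ x).
by rewrite !inE eqxx => /esym/eqP.
Qed.

Lemma sum_porbit_perm (T : finType) (p : {perm T}) (V : nmodType) (f : T -> V) x :
  \sum_(y in porbit p x) f (p y) = \sum_(y in porbit p x) f y.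
Proof.
rewrite [RHS](reindex_inj (@perm_inj _ p)); apply: eq_bigl => y /=.
by rewrite -!eq_porbit_mem; congr (_ == _); have := porbit_perm p 1 y; rewrite expg1.
Qed.

(** Three distinct elements exhaust F_3 and are in arithmetic progression in any order. Hence the
    color step around a cubic vertex is constant. *)
Lemma neq3_F3 (x y z : 'F_3) : x != y -> y != z -> x != z -> y - x = z - y.
Proof.
by case: (F3P x) => ->; case: (F3P y) => ->; case: (F3P z) => -> // _ _ _; apply: val_inj.
Qed.

Lemma pm1_F3 (x : 'F_3) : (x == -1) || (x == 1) = (x != 0).
Proof. by case: (F3P x) => ->. Qed.

Section Darts.
Variable G : sgraph.
Implicit Types d : dart G.

Definition dhead d : G := (val d).2.

Lemma dtail_rev d : dtail (Defs.rev d) = dhead d. Proof. by []. Qed.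
Lemma dhead_rev d : dhead (Defs.rev d) = dtail d. Proof. by []. Qed.

Lemma dart_inj d d' : dtail d = dtail d' -> dhead d = dhead d' -> d = d'.
Proof. by case: d d' => [[x y] ?] [[x' y'] ?] ? ?; apply: val_inj; congr pair. Qed.

Lemma dtail_neq_dhead d : dtail d != dhead d.
Proof.
case: d => -[x y] xy; rewrite /dtail /dhead /=; apply: contraTneq xy => /= ->.
by rewrite adj_irr.
Qed.

Lemma rev_neq d : Defs.rev d != d.
Proof. by apply: contraNneq (dtail_neq_dhead d) => {1}<-. Qed.

Definition edge_of d : edge G :=
  exist (fun A => A \in edges G) [set dtail d; dhead d]
    (imset_f (fun p : G * G => [set p.1; p.2]) (valP d)).

Lemma edge_ofP (A : edge G) : exists d, A = edge_of d.
Proof.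
case: A => A eA; have /imsetP[p adjp defA] := eA.
by exists (exist _ p adjp); apply: val_inj.
Qed.

Lemma edge_of_rev d : edge_of (Defs.rev d) = edge_of d.
Proof. by apply: val_inj; rewrite /= setUC. Qed.

Lemma edge_of_eq d d' : edge_of d = edge_of d' -> d = d' \/ d = Defs.rev d'.
Proof.
move/(congr1 val)/setP => /= eqA.
have := eqA (dhead d); have := eqA (dtail d); rewrite !inE !eqxx orbT /=.
have := dtail_neq_dhead d.
move=> neq /esym/orP[]/eqP tE /esym/orP[]/eqP hE; rewrite ?tE ?hE ?eqxx // in neq.
  by left; apply: dart_inj.
by right; apply: dart_inj.
Qed.

Lemma edge_of_inj d d' : dtail d = dtail d' -> edge_of d = edge_of d' -> d = d'.
Proof.
move=> tt /edge_of_eq[//|d_rev]; have := dtail_neq_dhead d'.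
by rewrite -tt d_rev dtail_rev eqxx.
Qed.

Lemma taitP (c : {ffun edge G -> 'I_3}) :
  reflect (forall d d', d != d' -> dtail d = dtail d' -> c (edge_of d) != c (edge_of d'))
    (is_tait_coloring c).
Proof.
apply: (iffP idP) => [/forallP tait d d' neq tt|tait].
  have /forallP/(_ (edge_of d'))/implyP := tait (edge_of d); apply.
  rewrite (contra_neq (edge_of_inj tt) neq); apply/set0Pn; exists (dtail d).
  by rewrite inE /= !inE tt !eqxx.
apply/forallP => A; apply/forallP => B; apply/implyP => /andP[neqAB /set0Pn[v]].
have ori (X : edge G) : v \in val X -> exists2 d, X = edge_of d & dtail d = v.
  have [d ->] := edge_ofP X; rewrite !inE => /orP[]/eqP ->; first by exists d.
  by exists (Defs.rev d); rewrite ?edge_of_rev.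
rewrite inE => /andP[/ori[d defA tv] /ori[d' defB tv']].
rewrite defA defB tait ?tv ?tv' //; apply: contraNneq neqAB => dd'.
by rewrite defA defB dd'.
Qed.

Lemma porbit_rev d : porbit (rev_perm G) d = [set d' | edge_of d' == edge_of d].
Proof.
have revE x : rev_perm G x = Defs.rev x by rewrite permE.
apply/setP => d'; rewrite inE; apply/idP/eqP => [/porbitP[i ->]|/edge_of_eq[]->].
- elim: i => [|i IHi]; first by rewrite expg0 perm1.
  by rewrite expgSr permM revE edge_of_rev.
- exact: porbit_id.
- by rewrite -revE; have := mem_porbit (rev_perm G) 1 d; rewrite expg1.
Qed.

Lemma card_porbits_rev : #|porbits (rev_perm G)| = #|edges G|.
Proof.
rewrite (card_porbits_fibers porbit_rev) -[RHS]card_sig -[RHS]cardsT.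
by apply: eq_card => A; rewrite !inE; have [d ->] := edge_ofP A; rewrite imset_f.
Qed.

Lemma card_dart : #|{: dart G}| = (2 * #|edges G|)%N.
Proof.
rewrite -[LHS]sum1_card (partition_big edge_of xpredT) //=.
rewrite -card_sig -[X in (2 * X)%N]sum1_card big_distrr; apply: eq_bigr => A _ /=.
have [d ->] := edge_ofP A; rewrite muln1 sum1dep_card -porbit_rev.
have -> : porbit (rev_perm G) d = [set d; Defs.rev d].
  rewrite porbit_rev; apply/setP => d'; rewrite !inE; apply/eqP/orP => [/edge_of_eq[]->|[]/eqP->].
  - by left.
  - by right.
  - by [].
  - by rewrite edge_of_rev.
by rewrite cards2 eq_sym rev_neq.
Qed.

Lemma card_darts_at (v : G) : #|[set d | dtail d == v]| = #|[set y | adj v y]|.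
Proof.
rewrite -(card_in_imset (f := dhead)) => [|d d']; last first.
  by rewrite !inE => /eqP tv /eqP tv' hh; apply: dart_inj; rewrite ?tv.
apply: eq_card => y; rewrite inE; apply/imsetP/idP => [[d]|vy].
  by rewrite inE => /eqP <- ->; apply: valP d.
by exists (exist (fun p : G * G => adj p.1 p.2) (v, y) vy); rewrite ?inE /dtail /=.
Qed.

(** Turning and reversing reach every dart of a connected graph. This gives the transitivity asked
    by [genus0_cocycle] and the uniqueness of a coloring up to a constant. *)
Lemma dart_fun_const (T : eqType) (s : {perm dart G}) (g : dart G -> T) :
  connected_graph G -> rotation_system s ->
  (forall d, g (Defs.rev d) = g d) -> (forall d, g (s d) = g d) -> forall d d', g d = g d'.
Proof.
move=> conn rot g_rev g_s.
have g_tail d d' : dtail d = dtail d' -> g d = g d'.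
  move/eqP => tt; have : d \in porbit s d' by rewrite rot inE.
  case/porbitP => i ->; elim: i => [|i IHi]; first by rewrite expg0 perm1.
  by rewrite expgSr permM g_s.
move=> d d'; have /connectP[p] := conn (dtail d) (dtail d').
elim: p d => [|y p IHp] d /=; first by move=> _ ?; apply: g_tail.
case/andP=> xy pathp lastp.
pose e : dart G := exist (fun p : G * G => adj p.1 p.2) (dtail d, y) xy.
by rewrite (g_tail d e) // -g_rev; apply: IHp.
Qed.

End Darts.

Section PlaneCubic.
Variables (G : sgraph) (s : {perm dart G}).
Hypotheses (cubicG : cubic G) (biconG : biconnected G) (planeG : plane_embedding s).
Implicit Types d : dart G.

Let rot : rotation_system s. Proof. by case: planeG. Qed.

Lemma dtail_rot d : dtail (s d) = dtail d.
Proof.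
have := mem_porbit s 1 d; rewrite expg1 rot inE.
by move/eqP.
Qed.

Lemma card_rot d : #|porbit s d| = 3.
Proof. by rewrite rot card_darts_at cubicG. Qed.

Lemma rot3 d : s (s (s d)) = d.
Proof. by have := iter_porbit s d; rewrite card_rot. Qed.

Lemma rot_neq d : s d != d.
Proof.
have := uniq_traject_porbit s d; rewrite card_rot /= !inE eq_sym.
by case: (s d == d).
Qed.

Lemma same_tailP d d' : dtail d = dtail d' -> [\/ d' = d, d' = s d | d = s d'].
Proof.
move/eqP => tt; have : d' \in porbit s d by rewrite rot inE eq_sym.
rewrite porbit_traject card_rot /= !inE => /or3P[]/eqP ->; first exact: Or31.
  exact: Or32.
by apply: Or33; rewrite rot3.
Qed.

Lemma dart_at v : exists d, dtail d = v.
Proof.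
have /card_gt0P[d] : (0 < #|[set d | dtail d == v]|)%N by rewrite card_darts_at cubicG.
by rewrite inE => /eqP <-; exists d.
Qed.

Lemma card_porbits_rot : #|porbits s| = #|G|.
Proof.
rewrite (card_porbits_fibers rot) -cardsT; apply: eq_card => v; rewrite inE.
by have [d <-] := dart_at v; rewrite imset_f.
Qed.

Lemma card_dart_cubic : #|{: dart G}| = (3 * #|G|)%N.
Proof.
rewrite -[LHS]sum1_card (partition_big (@dtail G) xpredT) //=.
rewrite -[X in (3 * X)%N]sum1_card big_distrr; apply: eq_bigr => v _ /=.
by rewrite muln1 sum1dep_card card_darts_at cubicG.
Qed.

(** Add the number of edges to both sides of V + F = E + 2: there are 2 E darts. *)
Lemma dart_euler :
  (#|porbits (rev_perm G)| + #|porbits s| + #|porbits (rev_perm G * s)%g| = #|{: dart G}| + 2)%N.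
Proof.
rewrite card_porbits_rev card_porbits_rot card_dart; have [_] := planeG.
by rewrite mul2n -addnn -!addnA => <-.
Qed.

(** The case of [genus0_cocycle] where [a] reverses darts and [b] turns around vertices; the
    antisymmetry of [phi] is its vanishing sum over the orbit of a dart and its reverse. *)
Lemma plane_cocycle (phi psi : dart G -> 'F_3) (d0 : dart G) :
  (forall d, phi (Defs.rev d) = - phi d) ->
  (forall d, \sum_(d' in porbit s d) psi d' = 0) ->
  (forall d, \sum_(d' in porbit (face_perm s) d) (phi d' + psi (Defs.rev d')) = 0) ->
  exists c : dart G -> 'F_3,
    (forall d, c (Defs.rev d) = c d + phi d) /\ (forall d, c (s d) = c d + psi d).
Proof.
move=> phi_rev psi0 face0.
have revE d : rev_perm G d = Defs.rev d by rewrite permE.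
have [||||d|c [c_rev c_s]] := @genus0_cocycle _ _ (rev_perm G) s phi psi d0.
- move=> g g_rev g_s d; have [conn _] := biconG.
  by apply: (dart_fun_const conn rot) => // d'; rewrite -revE.
- exact: dart_euler.
- move=> d; have -> : \sum_(y in porbit (rev_perm G) d) phi y = phi d + phi (Defs.rev d).
    rewrite (bigD1 d) ?porbit_id //=; congr (_ + _); apply: big_pred1 => d' /=.
    rewrite porbit_rev inE; apply/andP/eqP => [[/eqP/edge_of_eq[->|//]]|->].
      by rewrite eqxx.
    by rewrite edge_of_rev eqxx rev_neq.
  by rewrite phi_rev subrr.
- exact: psi0.
- by rewrite -[RHS](face0 d); apply: eq_bigr => d' _; rewrite revE.
by exists c; split=> // d; rewrite -revE.
Qed.

Lemma face_permE d : face_perm s d = s (Defs.rev d).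
Proof. by rewrite permM permE. Qed.

(* A face passing through both sides of an edge [d] makes the indicator of [d] *)
(* a cocycle, hence [d] a bridge: its potential is constant on paths avoiding  *)
(* [d], but jumps along [d].                                                   *)
Lemma rot_notin_face d : s d \notin porbit (face_perm s) d.
Proof.
apply/negP => sd_face.
have rev_face : Defs.rev d \in porbit (face_perm s) d.
  have := sd_face; rewrite -{1}(Defs.revK d) -face_permE -!eq_porbit_mem.
  by have := porbit_perm (face_perm s) 1 (Defs.rev d); rewrite expg1 => ->.
pose phi x : 'F_3 := (x == d)%:R - (x == Defs.rev d)%:R.
have [x|x|x|c [c_rev c_s]] := @plane_cocycle phi (fun=> 0) d.
- by rewrite /phi (can_eq (@Defs.revK G)) (can2_eq (@Defs.revK G) (@Defs.revK G)) opprB.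
- by rewrite big1.
- under eq_bigr do rewrite addr0.
  have count_one y : \sum_(z in porbit (face_perm s) x) (z == y)%:R
      = (y \in porbit (face_perm s) x)%:R :> 'F_3.
    rewrite big_mkcond (bigD1 y) //= eqxx big1 ?addr0 => [|z /negPf->].
      by case: (y \in _).
    by case: (z \in _).
  rewrite sumrB !count_one -!(porbit_sym _ x) -!eq_porbit_mem.
  by move: rev_face; rewrite -eq_porbit_mem => /eqP ->; rewrite subrr.
have c_tail x y : dtail x = dtail y -> c x = c y.
  by case/same_tailP => ->; rewrite ?c_s ?addr0.
have c_edge x : x != d -> x != Defs.rev d -> c (Defs.rev x) = c x.
  by rewrite c_rev /phi => /negPf -> /negPf ->; rewrite subrr addr0.
pose v := dtail d.
have avoid x y : connect (adj_minus v) (dtail x) (dtail y) -> c x = c y.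
  case/connectP => p; elim: p x => [|z p IHp] x /=.
    by move=> _ /esym; apply: c_tail.
  case/andP => /and3P[xz xv zv] pathp lastp.
  pose e : dart G := exist (fun p : G * G => adj p.1 p.2) (dtail x, z) xz.
  rewrite (c_tail x e) // -c_edge; first exact: IHp.
    by apply: contraNneq xv => ed; rewrite /v -ed.
  by apply: contraNneq zv => ed; rewrite /v -dhead_rev -ed.
have [_ nocut] := biconG.
(* As [v] is no cut vertex, the heads of [d] and [s d] are joined by a path avoiding [v], hence
   avoiding [d]. Returning along [s d] gives [c (rev d) = c d], against the jump of 1 along [d]. *)
have : c (Defs.rev d) = c (Defs.rev (s d)).
  apply: avoid; rewrite !dtail_rev; apply/negPn/negP => cut; apply: (nocut v).
  exists (dhead d), (dhead (s d)); split=> //; rewrite eq_sym ?dtail_neq_dhead //.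
  by rewrite /v -dtail_rot dtail_neq_dhead.
rewrite c_rev [c (Defs.rev (s d))]c_edge ?rot_neq //; last first.
  by apply: contraNneq (dtail_neq_dhead d) => sd; rewrite -dtail_rot sd dtail_rev.
rewrite c_s addr0 /phi eqxx (negPf (_ : d != Defs.rev d)) ?subr0; last by rewrite eq_sym rev_neq.
by rewrite -[RHS]addr0 => /addrI.
Qed.

(** At a cubic vertex, two distinct darts are consecutive under [s] in one order or the other, so
    [rot_notin_face] keeps them on different faces. *)
Lemma face_dtail_inj d : {in porbit (face_perm s) d &, injective (@dtail G)}.
Proof.
move=> x y; rewrite -!eq_porbit_mem => /eqP xd /eqP yd /same_tailP[-> // | yE | xE].
  by case/negP: (rot_notin_face x); rewrite -yE -eq_porbit_mem xd yd.
by case/negP: (rot_notin_face y); rewrite -xE -eq_porbit_mem xd yd.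
Qed.

Lemma sum_on_face (e : G -> 'F_3) d :
  \sum_(v | on_face v (porbit (face_perm s) d)) e v
    = \sum_(d' in porbit (face_perm s) d) e (dtail d').
Proof.
rewrite -(big_imset e (@face_dtail_inj d)) /=; apply: eq_bigl => v.
apply/exists_inP/imsetP => [[d' Fd' /eqP <-]|[d' Fd' ->]]; first by exists d'.
by exists d'.
Qed.

(** Face sums run over darts, the form that [plane_cocycle] integrates; [sum_on_face] translates
    them to vertices. *)
Definition heawood : {set {ffun G -> 'F_3}} :=
  [set e | pm1 e && [forall d, \sum_(d' in porbit (face_perm s) d) e (dtail d') == 0]].

(** A coloring corresponds to its Heawood labelling together with the color at [d0]. *)
Lemma card_tait (d0 : dart G) : #|tait_colorings G| = (3 * #|heawood|)%N.
Proof.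
have [dv dvP] := fin_all_exists dart_at; have [de deP] := fin_all_exists (@edge_ofP G).
pose col (c : {ffun edge G -> 'I_3}) d : 'F_3 := c (edge_of d).
pose heaw c : {ffun G -> 'F_3} := [ffun v => col c (s (dv v)) - col c (dv v)].
pose Phi c := (heaw c, col c d0).
have col_rev c d : col c (Defs.rev d) = col c d by rewrite /col edge_of_rev.
have heawE c d : is_tait_coloring c -> col c (s d) - col c d = heaw c (dtail d).
  move/taitP => tait.
  have step x : col c (s (s x)) - col c (s x) = col c (s x) - col c x.
    apply/esym/neq3_F3; rewrite eq_sym; apply: tait; rewrite ?dtail_rot ?rot_neq //.
    by rewrite -{2}[x]rot3 eq_sym rot_neq.
  by rewrite ffunE; case: (same_tailP (dvP (dtail d))) => [<-|{1 2}->|->]; rewrite ?step.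
have Phi_inj : {in tait_colorings G &, injective Phi}.
  move=> c c'; rewrite !inE => tc tc' [/ffunP heawcc' cd0].
  (* Two colorings with the same labelling differ by a function invariant under [rev] and [s], hence
     by a constant, which is 0 at [d0]. *)
  pose g d := col c d - col c' d.
  have g_const d : g d = g d0.
    have [conn _] := biconG.
    apply: (dart_fun_const conn rot) => x; rewrite /g ?col_rev //.
    have := heawE c' x tc'; rewrite -heawcc' -heawE // => dcc'.
    by apply/eqP; rewrite -subr_eq0 -(subrr (col c (s x) - col c x)) -{2}dcc'; apply/eqP; ring.
  apply/ffunP => A; rewrite (deP A); apply/eqP; rewrite -subr_eq0.
  by rewrite -/(col c _) -/(col c' _) -/(g _) g_const /g -cd0 subrr.
rewrite -(card_in_imset Phi_inj).
have -> : Phi @: tait_colorings G = setX heawood [set: 'F_3].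
  apply/setP => -[e t]; rewrite !inE andbT; apply/imsetP/andP => /=.
    case=> c; rewrite inE => tc [-> _]; split.
      apply/forallP => v; rewrite pm1_F3 ffunE subr_eq0.
      by apply: (taitP _ tc); rewrite ?dtail_rot ?rot_neq.
    apply/forallP => d; rewrite -(sum_porbit_perm _ (fun x => heaw c (dtail x))).
    under eq_bigr do rewrite face_permE dtail_rot -heawE // -face_permE col_rev.
    by rewrite sumrB (sum_porbit_perm _ (col c)) subrr.
  case=> /forallP e1 /forallP eface.
  have e_nz v : e v != 0 by rewrite -pm1_F3.
  (* With [phi] zero the potential [k] descends to edges. The sum of [psi] around a vertex is 3 e =
     0, and around a face it vanishes by assumption. *)
  have [|d|d|k [k_rev k_s]] := @plane_cocycle (fun=> 0) (fun d => e (dtail d)) d0.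
  - by move=> d; rewrite oppr0.
  - rewrite (eq_bigr (fun=> e (dtail d))) => [|x]; last by rewrite rot inE => /eqP ->.
    by rewrite sumr_const card_rot; case: (F3P (e (dtail d))) => ->; apply: val_inj.
  - rewrite -[RHS](eqP (eface d)) -[RHS](sum_porbit_perm _ (fun x => e (dtail x))).
    by apply: eq_bigr => x _; rewrite add0r face_permE dtail_rot.
  pose c : {ffun edge G -> 'I_3} := [ffun A => k (de A) - k d0 + t : 'F_3].
  have colE d : col c d = k d - k d0 + t.
    rewrite /col ffunE; suff -> : k (de (edge_of d)) = k d by [].
    by have /edge_of_eq[{2}->|{2}->] := deP (edge_of d); rewrite // k_rev addr0.
  have tc : is_tait_coloring c.
    have neq_s x : c (edge_of (s x)) != c (edge_of x).
      rewrite -/(col c (s x)) -/(col c x) !colE k_s.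
      by rewrite -subr_eq0 (_ : _ - _ = e (dtail x)) //; ring.
    apply/taitP => x y neq /same_tailP[yx|->|->]; first by rewrite yx eqxx in neq.
      by rewrite eq_sym.
    exact: neq_s.
  exists c; rewrite ?inE //; congr pair; last by rewrite colE subrr add0r.
  apply/ffunP => v; rewrite ffunE !colE k_s dvP; ring.
by rewrite cardsX cardsT card_ord mulnC.
Qed.

End PlaneCubic.

Theorem theorem2 (G : sgraph) (s : {perm dart G}) (n : nat) :
  cubic G -> biconnected G -> plane_embedding s ->
  (2 <= n)%N -> #|edges G| = (3 * n)%N ->
  [/\ #|G| = (2 * n)%N,
      #|faces s| = (n + 2)%N
    & forall F : 'I_(n + 2) -> {set dart G},
        injective F -> [set F i | i : 'I_(n + 2)] = faces s ->
        #|tait_colorings G|%:R =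
        3 * \sum_(alpha : {ffun G -> 'F_3} |
                    [forall v, (alpha v == -1) || (alpha v == 1)]
                    && ~~ odd (\rank (FM F alpha)))
              (- (1 / 3)) ^+ (\rank (FM F alpha))./2 * mxsign (FM F alpha)
        :> rat].
Proof.
move=> cubicG biconG planeG n2 cardE.
have cardG : #|G| = (2 * n)%N.
  by have := card_dart_cubic cubicG; rewrite card_dart cardE; lia.
have [_] := planeG; rewrite cardG cardE => euler.
split=> [//||F _ facesF]; first by lia.
have /card_gt0P[v _] : (0 < #|G|)%N by rewrite cardG; lia.
have [d0 _] := dart_at cubicG v.
rewrite (card_tait cubicG biconG planeG d0) natrM; congr (_ * _).
rewrite (signed_rank_sum (fun v i => on_face v (F i))); congr (_%:R).
apply: eq_card => e; rewrite !inE; congr (_ && _).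
apply/forallP/forallP => [sum0 i|sum0 d].
  have : F i \in faces s by rewrite -facesF imset_f.
  by case/imsetP => d _ ->; rewrite sum_on_face.
have : porbit (face_perm s) d \in faces s by rewrite imset_f.
by rewrite -facesF => /imsetP[i _ defF]; rewrite -(sum_on_face cubicG) // defF.
Qed.
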